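(* Let $d,n\ge1$, let $\kappa\ge1$ divide $d$, $d'=d/\kappa$, $r\ge2$, $\mathbf r=(r,\dots,r)\in\mathbb{N}^d$ and $\mathbf r'=(r^\kappa,\dots,r^\kappa)\in\mathbb{N}^{d'}$. Let $A_1,\dots,A_{d'}\in\mathbb{R}^{m\times n^\kappa}$, $\mathcal{A}(\mathcal{Y})=\mathcal{Y}\times_1A_1\times_2\cdots\times_{d'}A_{d'}$, let $A_{2nd}\in\mathbb{R}^{m_{2nd}\times m^{d'}}$ and $\mathcal{A}_{2nd}(\mathcal{X})=A_{2nd}(\mathrm{vect}(\mathcal{A}(\mathcal{R}(\mathcal{X}))))$. Assume each $A_i$ has the RIP$(\varepsilon,\mathcal{S}_{1,2})$ property, where $\delta=12d'r^d\varepsilon<1$, and that the map $\mathcal{Z}\mapsto A_{2nd}\,\mathrm{vect}(\mathcal{Z})$ has the RIP$(\delta/3,\mathcal{B}_{1+\varepsilon,\varepsilon,1-\delta/3,\mathbf r'})$ property, where $\mathcal{B}$ is taken among $d'$-mode tensors in $\mathbb{R}^{m\times\cdots\times m}$. Then for all $\mathcal{X}\in\mathbb{R}^{n\times\cdots\times n}$ ($d$ modes) with HOSVD rank at most $\mathbf r$, $$(1-\delta)\|\mathcal{X}\|^2\le\|\mathcal{A}_{2nd}(\mathcal{X})\|^2\le(1+\delta)\|\mathcal{X}\|^2.$$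
   Context: $\|\cdot\|$ is the Frobenius (resp. Euclidean) norm; $\mathrm{vect}$ is vectorization. The $j$-mode product: $(\mathcal{X}\times_jU)_{i_1,\dots,\ell,\dots,i_D}=\sum_{i_j}\mathcal{X}_{i_1,\dots,i_j,\dots,i_D}U_{\ell,i_j}$. HOSVD rank at most $(r,\dots,r)$ means $\mathcal{X}\in\mathcal{U}_1\otimes\cdots\otimes\mathcal{U}_d$ with subspaces $\mathcal{U}_i\subset\mathbb{R}^n$, $\dim\mathcal{U}_i=r$. $\mathcal{R}$ is the linear reshaping map with $\mathcal{R}(\mathbf{x}^1\circ\cdots\circ\mathbf{x}^d)=\bigcirc_{i=1}^{d'}(\mathbf{x}^{\kappa(i-1)+1}\otimes\cdots\otimes\mathbf{x}^{\kappa i})$ ($\circ$ outer, $\otimes$ Kronecker product). $\mathcal{S}_1=\{\mathbf{u}^1\otimes\cdots\otimes\mathbf{u}^\kappa:\mathbf{u}^i\in\mathbb{S}^{n-1}\}$, $\mathcal{S}_2=\{(\mathbf{x}+\mathbf{y})/\|\mathbf{x}+\mathbf{y}\|_2:\mathbf{x},\mathbf{y}\in\mathcal{S}_1,\langle\mathbf{x},\mathbf{y}\rangle=0\}$, $\mathcal{S}_{1,2}=\mathcal{S}_1\cup\mathcal{S}_2$. A linear map $L$ has RIP$(\varepsilon,\mathcal{S})$ if $(1-\varepsilon)\|s\|^2\le\|L(s)\|^2\le(1+\varepsilon)\|s\|^2$ for all $s\in\mathcal{S}$. For $R\ge0$, $\mu,\theta\ge0$ and $\mathbf s=(s,\dots,s)\in\mathbb{N}^D$,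 the set $\mathcal{B}_{R,\mu,\theta,\mathbf s}$ of nearly orthogonal $D$-mode tensors in $\mathbb{R}^{p\times\cdots\times p}$ consists of those $\mathcal{X}$ that can be written $\mathcal{X}=\sum_{k_1,\dots,k_D=1}^{s}\mathcal{C}(k_1,\dots,k_D)\,\mathbf{u}^1_{k_1}\circ\cdots\circ\mathbf{u}^D_{k_D}$ with $\mathbf{u}^i_k\in\mathbb{R}^p$ such that (a) $\|\mathbf{u}^i_{k}\|_2\le R$ for all $i,k$; (b) $|\langle\mathbf{u}^i_k,\mathbf{u}^i_{k'}\rangle|\le\mu$ for all $i$ and $k\ne k'$; (c) $\|\mathcal{C}\|_F=1$; (d) $\mathcal{C}$ has orthogonal subtensors: for every $i$ and $p'\ne q$, $\sum_{k_j,\,j\ne i}\mathcal{C}(k_1,\dots,p',\dots,k_D)\mathcal{C}(k_1,\dots,q,\dots,k_D)=0$ (with $p',q$ in position $i$); (e) $\|\mathcal{X}\|_F\ge\theta$. *)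

(* Defs.v *)
From HB Require Import structures.
From mathcomp Require Import all_boot all_order all_algebra.
From mathcomp Require Import reals.
Set Implicit Arguments. Unset Strict Implicit. Unset Printing Implicit Defensive.
Import Order.TTheory GRing.Theory Num.Theory.
Local Open Scope ring_scope.

Section Defs.
Variable R : realType.

Definition sqnorm (I : finType) (v : I -> R) : R := \sum_i v i ^+ 2.
Definition enorm (I : finType) (v : I -> R) : R := Num.sqrt (sqnorm v).
Definition inner (I : finType) (u v : I -> R) : R := \sum_i u i * v i.

Definition matvec (I O : finType) (A : O -> I -> R) (v : I -> R) : O -> R :=
  fun o => \sum_i A o i * v i.

Definition RIP (I O : finType) (L : (I -> R) -> (O -> R)) (eps : R)
  (S : (I -> R) -> Prop) : Prop :=
  forall s, S s -> (1 - eps) * sqnorm s <= sqnorm (L s) <= (1 + eps) * sqnorm s.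

(* R^{n^k} is indexed by multi-indices {ffun 'I_k -> 'I_n};
   Kronecker product u^1 (x) ... (x) u^k *)
Definition kron (k n : nat) (u : 'I_k -> 'I_n -> R) : {ffun 'I_k -> 'I_n} -> R :=
  fun j => \prod_(c < k) u c (j c).

Definition S1 (k n : nat) (s : {ffun 'I_k -> 'I_n} -> R) : Prop :=
  exists u : 'I_k -> 'I_n -> R,
    (forall c, enorm (u c) = 1) /\ forall j, s j = kron u j.

Definition S2 (k n : nat) (s : {ffun 'I_k -> 'I_n} -> R) : Prop :=
  exists x y, S1 x /\ S1 y /\ inner x y = 0 /\
    forall j, s j = (x j + y j) / enorm (fun j => x j + y j).

Definition S12 (k n : nat) (s : {ffun 'I_k -> 'I_n} -> R) : Prop := S1 s \/ S2 s.

(* reshaping map: a d-mode tensor X (indices {ffun 'I_d -> 'I_n}) becomes a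
   (d %/ k)-mode tensor whose b-th index j b ranges over R^{n^k}; the
   0-based index k*b + c of X is j b c.  When k >= 1 divides d, exactly one
   multi-index i matches j, so the sum below is just X at that index. *)
Definition reshape_match (d k n : nat) (i : {ffun 'I_d -> 'I_n})
  (j : {ffun 'I_(d %/ k) -> {ffun 'I_k -> 'I_n}}) : bool :=
  [forall a : 'I_d, forall b : 'I_(d %/ k), forall c : 'I_k,
     (val a == k * val b + val c)%N ==> (i a == j b c)].

Definition reshape (d k n : nat) (X : {ffun 'I_d -> 'I_n} -> R)
  : {ffun 'I_(d %/ k) -> {ffun 'I_k -> 'I_n}} -> R :=
  fun j => \sum_(i | reshape_match i j) X i.

Definition modeprod (D m : nat) (J : finType) (A : 'I_D -> 'I_m -> J -> R)
  (Y : {ffun 'I_D -> J} -> R) : {ffun 'I_D -> 'I_m} -> R :=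
  fun l => \sum_(j : {ffun 'I_D -> J}) (\prod_(b < D) A b (l b) (j b)) * Y j.

(* A_2nd(X) = A2 vect(A(R(X))); columns of A2 indexed by multi-indices *)
Definition A2nd (d k n m m2 : nat)
  (A2 : 'I_m2 -> {ffun 'I_(d %/ k) -> 'I_m} -> R)
  (A : 'I_(d %/ k) -> 'I_m -> {ffun 'I_k -> 'I_n} -> R)
  (X : {ffun 'I_d -> 'I_n} -> R) : 'I_m2 -> R :=
  matvec A2 (modeprod A (reshape X)).

Definition upd (D s : nat) (kk : {ffun 'I_D -> 'I_s}) (b : 'I_D) (q : 'I_s)
  : {ffun 'I_D -> 'I_s} := [ffun c => if c == b then q else kk c].

Definition nearly_orth (D p s : nat) (Rad mu theta : R)
  (X : {ffun 'I_D -> 'I_p} -> R) : Prop :=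
  exists (u : 'I_D -> 'I_s -> 'I_p -> R) (C : {ffun 'I_D -> 'I_s} -> R),
    (forall l, X l = \sum_(kk : {ffun 'I_D -> 'I_s}) C kk * \prod_(b < D) u b (kk b) (l b)) /\
    (forall b kk, enorm (u b kk) <= Rad) /\
    (forall b kk kk', kk != kk' -> `|inner (u b kk) (u b kk')| <= mu) /\
    enorm C = 1 /\
    (forall b (p' q : 'I_s), p' != q ->
       \sum_(kk : {ffun 'I_D -> 'I_s} | kk b == p') C kk * C (upd kk b q) = 0) /\
    theta <= enorm X.

(* HOSVD rank at most (r,..,r): X in U_1 (x) ... (x) U_d, dim U_a = r,
   U_a given as the row space of a rank-r matrix in R^{r x n} *)
Definition hosvd_le (d n r : nat) (X : {ffun 'I_d -> 'I_n} -> R) : Prop :=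
  exists U : 'I_d -> 'M[R]_(r, n),
    (forall a, \rank (U a) = r) /\
    exists G : {ffun 'I_d -> 'I_r} -> R,
      forall i, X i = \sum_(kk : {ffun 'I_d -> 'I_r}) G kk * \prod_(a < d) U a (kk a) (i a).

End Defs.

(* Main.v *)
Require Import Defs.
From HB Require Import structures.
From mathcomp Require Import all_boot all_order all_algebra.
From mathcomp Require Import reals.
From mathcomp Require Import ring lra complex.
Set Implicit Arguments. Unset Strict Implicit. Unset Printing Implicit Defensive.
Import Order.TTheory GRing.Theory Num.Theory.
Local Open Scope ring_scope.

(** The second-stage hypothesis is applied to [Z / |Z|], where [Z] is the tensor
    compressed by the first stage: the higher-order SVD of [Z] itself (rather than
    the image of the one of [X]) has an orthonormal frame and a core with orthogonal
    subtensors, so [Z / |Z|] is nearly orthogonal with radius 1 and coherence 0.  It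
    remains to compare [|Z|] with [|X|].  In an orthonormal product frame of the
    reshaped [X], the RIP on [S12] and polarization say that the Gram matrix of each
    compressed frame is entrywise [eps]-close to the identity; hence [|Z|^2] is a
    quadratic form in the core whose deviation from [|X|^2] has row sums at most
    [(1 + r^k eps)^(d/k) - 1].  All orthonormal frames come from the diagonalization
    of real symmetric matrices. *)

(** * Diagonalization of real symmetric matrices and the orthonormal frames it yields *)

Section RealSpectral.
Variable R : rcfType.

Lemma mulmx_trmxE (m n p : nat) (M : 'M[R]_(m, n)) (N : 'M[R]_(p, n)) i j :
  (M *m N^T) i j = \sum_k M i k * N j k.
Proof. by rewrite mxE; apply: eq_bigr => k _; rewrite mxE. Qed.

Lemma mulmx_trmx_diag (m n : nat) (M : 'M[R]_(m, n)) i :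
  (M *m M^T) i i = \sum_j M i j ^+ 2.
Proof. by rewrite mulmx_trmxE; apply: eq_bigr => j _; rewrite expr2. Qed.

Lemma mulmx_trmx_gt0 (n : nat) (v : 'rV[R]_n) : v != 0 -> 0 < (v *m v^T) 0 0.
Proof.
move=> v0; rewrite mulmx_trmx_diag lt_neqAle eq_sym sumr_ge0 ?andbT.
  apply: contraNneq v0 => /psumr_eq0P v0; apply/eqP/rowP => j; rewrite mxE.
  by apply/eqP; rewrite -sqrf_eq0 v0 // => i _; apply: sqr_ge0.
by move=> j _; apply: sqr_ge0.
Qed.

(** Over the complex extension of [R], [S] becomes hermitian, so the spectral theorem supplies an
    eigenvalue, and it is real. Being an eigenvalue descends along the field embedding. *)
Lemma sym_eigenvalue (n : nat) (S : 'M[R]_n.+1) :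
  S^T = S -> exists a, eigenvalue S a.
Proof.
move=> symS; pose SC := map_mx (real_complex R) S.
have hermS : SC \is hermsymmx.
  apply: realsym_hermsym.
    by apply/is_hermitianmxP; rewrite expr0 scale1r map_mx_id // map_trmx symS.
  by apply/mxOverP => i j; rewrite mxE; apply/complex_realP; exists (S i j).
have specS := orthomx_spectralP (hermitian_normalmx hermS).
have /mxOverP/(_ 0 0)/complex_realP[a aE] := hermitian_spectral_diag_real hermS.
exists a; suff : eigenvalue SC (a%:C)%C by rewrite eigenvalue_map.
rewrite -aE; have unitP := spectral_unit SC.
apply/eigenvalueP; exists (row 0 (spectralmx SC)).
  rewrite -row_mul [in X in _ *m X]specS !mulmxA mulmxV // mul1mx.
  by apply/rowP => j; rewrite mxE mul_diag_mx !mxE.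
rewrite rowE mulmx_free_eq0 ?row_free_unit //.
by apply/eqP => /rowP/(_ 0)/eqP; rewrite !mxE eqxx oner_eq0.
Qed.

(** The reflection that negates [w = e - v] and fixes its orthogonal complement exchanges the unit
    vectors [e] and [v]. *)
Lemma householder (n : nat) (v : 'rV[R]_n.+1) : v *m v^T = 1%:M ->
  exists H : 'M[R]_n.+1, [/\ H *m H^T = 1%:M, H^T = H & delta_mx 0 0 *m H = v].
Proof.
move=> v1; pose e : 'rV[R]_n.+1 := delta_mx 0 0.
have [->|ve] := eqVneq v e.
  by exists 1%:M; rewrite mulmx1 trmx1 mulmx1.
have ee : e *m e^T = 1%:M by rewrite trmx_delta mul_delta_mx; apply/rowP=>j; rewrite !ord1 !mxE.
pose w : 'rV[R]_n.+1 := e - v; pose q : R := (w *m w^T) 0 0.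
have w0 : w != 0 by rewrite subr_eq0 eq_sym.
have q0 : q != 0 by rewrite lt0r_neq0 ?mulmx_trmx_gt0.
have wwE : w *m w^T = q%:M by rewrite [LHS]mx11_scalar.
pose H : 'M[R]_n.+1 := 1%:M - (2 / q) *: (w^T *m w).
have HT : H^T = H by rewrite linearB /= trmx1 linearZ /= trmx_mul trmxK.
exists H; split => //.
  have MM : (w^T *m w) *m (w^T *m w) = q *: (w^T *m w).
    by rewrite -mulmxA (mulmxA w) wwE mul_scalar_mx -scalemxAr.
  rewrite HT mulmxBl mul1mx mulmxBr mulmx1 -scalemxAl -scalemxAr MM !scalerA.
  have -> : 2 / q * (2 / q) * q = 2 / q + 2 / q by field.
  by rewrite scalerDl /H; apply/matrixP => i j; rewrite !mxE; ring.
(* Since [e] and [v] have equal length, twice the inner product of [e] and [w] is the squared length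
   [q] of [w]; hence [e *m H = e - w = v]. *)
have ew : 2 *: (e *m w^T) = q%:M.
  have sc (x y : 'rV[R]_n.+1) : x *m y^T = y *m x^T.
    by apply/matrixP => i j; rewrite !ord1 !mxE; apply: eq_bigr => k _; rewrite !mxE mulrC.
  rewrite -wwE /w linearB /= !(mulmxBr, mulmxBl) ee v1 (sc v e).
  by apply/matrixP => i j; rewrite !ord1 !mxE; ring.
rewrite mulmxBr mulmx1 -scalemxAr mulmxA scalemxAl mulrC -scalerA ew.
by rewrite scale_scalar_mx mulVf // mul1mx /w opprB addrCA subrr addr0.
Qed.

(** Deflation: a Householder reflection moves a unit eigenvector to the first basis vector. By
    symmetry the conjugated matrix splits into the eigenvalue and a symmetric block of smaller
    size. *)
Lemma sym_diagonalizable (n : nat) (S : 'M[R]_n) : S^T = S ->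
  exists P (D : 'rV[R]_n), P *m P^T = 1%:M /\ P *m S *m P^T = diag_mx D.
Proof.
elim: n S => [|n IHn] S symS.
  by exists 1%:M, 0; split; apply/matrixP; case.
have [a /eigenvalueP[v0 v0S v0N0]] := sym_eigenvalue symS.
have q0 := mulmx_trmx_gt0 v0N0; set q := (_ *m _) 0 0 in q0.
pose v := (Num.sqrt q)^-1 *: v0.
have vS : v *m S = a *: v by rewrite -scalemxAl v0S !scalerA mulrC.
have vv : v *m v^T = 1%:M.
  rewrite linearZ /= -scalemxAl -scalemxAr scalerA [_ *m _]mx11_scalar -/q.
  by rewrite scale_scalar_mx -invfM -expr2 sqr_sqrtr ?ltW // mulVf ?lt0r_neq0.
have [H [HH HT eH]] := householder vv.
pose B0 := H *m S *m H^T.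
have B0T : B0^T = B0 by rewrite /B0 !trmx_mul trmxK symS mulmxA.
have eB : delta_mx 0 0 *m B0 = a *: delta_mx 0 0 :> 'rV_n.+1.
  by rewrite /B0 !mulmxA eH vS -scalemxAl -eH -mulmxA HH mulmx1.
(* A copy of [B0] typed at size [1 + n], the shape required by block matrices. *)
have [B defB] : exists B : 'M[R]_(1 + n), B = B0 by exists B0.
have BT : B^T = B by rewrite defB.
have Brow0 (i j : 'I_(1 + n)) : i = 0 :> nat -> B i j = a *+ (j == 0 :> nat).
  move=> i0; have -> : i = 0 by apply: val_inj.
  by move/rowP/(_ j): eB; rewrite -defB -rowE !mxE eqxx /= mulr_natr.
have BE : B = block_mx a%:M 0 0 (drsubmx B).
  rewrite -[LHS]submxK; congr block_mx; apply/matrixP => i j.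
  - by rewrite !ord1 !mxE Brow0.
  - by rewrite !ord1 !mxE Brow0.
  - by rewrite -[B]BT !ord1 !mxE Brow0.
have [|P [D [PP PD]]] := IHn (drsubmx B); first by rewrite -{2}BT trmx_drsub.
pose K : 'M[R]_(1 + n) := block_mx 1%:M 0 0 P.
pose E : 'rV[R]_(1 + n) := row_mx a%:M D.
have KK : K *m K^T = 1%:M.
  rewrite /K tr_block_mx trmx1 !trmx0 mulmx_block !mulmx0 !mul0mx !mulmx1.
  by rewrite !addr0 !add0r PP -scalar_mx_block.
have KB : K *m B *m K^T = diag_mx E.
  rewrite /K BE tr_block_mx trmx1 !trmx0 !mulmx_block !mulmx0 !mul0mx.
  rewrite !(mulmx1, mul1mx, mul0mx, mulmx0, addr0, add0r) PD diag_mx_row.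
  by congr block_mx; apply/matrixP => i j; rewrite !ord1 !mxE.
rewrite defB in KB; exists ((K : 'M_n.+1) *m H), (E : 'rV_n.+1); split.
  rewrite trmx_mul mulmxA -[K *m H *m H^T]mulmxA HH mulmx1.
  exact: KK.
by rewrite -KB /B0 trmx_mul !mulmxA.
Qed.

(** With the Gram matrix of the rows written as [P^T D P], the rows of [D^(-1/2) P U] are
    orthonormal, and [P^T D^(1/2)] recovers [U]. *)
Lemma orthonormal_factor (r n : nat) (U : 'M[R]_(r, n)) : row_free U ->
  exists (T : 'M[R]_r) (Q : 'M[R]_(r, n)), U = T *m Q /\ Q *m Q^T = 1%:M.
Proof.
move=> freeU.
have [|P [D [PP PD]]] := @sym_diagonalizable _ (U *m U^T).
  by rewrite trmx_mul trmxK.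
have PTP : P^T *m P = 1%:M by apply: mulmx1C.
(* [D 0 i] is the squared length of row [i] of [P *m U], which is nonzero because [U] has free rows
   and row [i] of [P] is a unit vector. *)
have D0 i : 0 < D 0 i.
  have -> : D 0 i = (row i (P *m U) *m (row i (P *m U))^T) 0 0.
    move/matrixP/(_ i i): PD; rewrite [RHS]mxE eqxx mulr1n => <-.
    rewrite mulmxA -mulmxA -trmx_mul !mulmx_trmx_diag.
    by apply: eq_bigr => j _; rewrite [in RHS]mxE.
  apply: mulmx_trmx_gt0; rewrite row_mul mulmx_free_eq0 //.
  apply/eqP => Pi0; move/matrixP/(_ i i): PP.
  rewrite mulmx_trmx_diag mxE eqxx big1 => [/esym/eqP|j _].
    by rewrite oner_eq0.
  by move/rowP/(_ j): Pi0; rewrite !mxE => ->; rewrite expr0n.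
pose L := diag_mx (map_mx Num.sqrt D); pose L' := diag_mx (map_mx (fun x => (Num.sqrt x)^-1) D).
have LL' : L *m L' = 1%:M.
  rewrite mulmx_diag; apply/matrixP => i j; rewrite !mxE mulfV //.
  by rewrite gt_eqF // sqrtr_gt0.
exists (P^T *m L), (L' *m P *m U); split.
  by rewrite !mulmxA -(mulmxA P^T) LL' mulmx1 PTP mul1mx.
have L'T : L'^T = L' by rewrite tr_diag_mx.
rewrite -!mulmxA trmx_mul !mulmxA trmx_mul L'T !mulmxA.
rewrite -(mulmxA L' P) -(mulmxA L' _ U^T) -(mulmxA L' _ P^T) mulmxA in PD *.
rewrite PD !mulmx_diag; apply/matrixP => i j; rewrite !mxE.
case: eqP => [->|]; rewrite ?mulr0n // !mulr1n.
rewrite -{2}(sqr_sqrtr (ltW (D0 j))); field.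
by rewrite gt_eqF // sqrtr_gt0.
Qed.

(* The rank of [W] may be smaller than [s]; the missing rows of [u] are zero. *)
Lemma diagonalizing_factor (s m : nat) (W : 'M[R]_(s, m)) (G : 'M[R]_s) : G^T = G ->
  exists (T : 'M[R]_s) (u : 'M[R]_(s, m)),
    [/\ W = T *m u, T *m T^T = W *m W^T, u *m u^T = pid_mx (\rank W) &
        is_diag_mx (T^T *m G *m T)].
Proof.
move=> symG; set rho := \rank W.
have rho_s : (rho <= s)%N by apply: rank_leq_row.
(* The rows of [Q] are an orthonormal basis of the row space of [W]. Passing from the pair [T1], [Q]
   to [T1 *m P^T], [P *m Q] keeps the product and [T *m T^T], and leaves [P] free to diagonalize
   [T1^T *m G *m T1]. Finally [J] pads from [rho] to [s]. *)
have [T0 [Q [QE QQ]]] := orthonormal_factor (row_base_free W).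
have [T1 WE] : exists T1, W = T1 *m Q.
  by exists (col_base W *m T0); rewrite -mulmxA -QE mulmx_base.
have [|P [D [PP PD]]] := @sym_diagonalizable _ (T1^T *m G *m T1).
  by rewrite !trmx_mul trmxK symG mulmxA.
have PTP : P^T *m P = 1%:M by apply: mulmx1C.
pose J : 'M[R]_(rho, s) := pid_mx rho.
have JJ : J *m J^T = 1%:M by rewrite tr_pid_mx pid_mx_id // pid_mx_1.
exists (T1 *m P^T *m J), (J^T *m P *m Q); split.
- by rewrite !mulmxA -(mulmxA _ J) JJ mulmx1 -(mulmxA T1) PTP mulmx1.
- rewrite !trmx_mul trmxK !mulmxA -(mulmxA _ J) JJ mulmx1 -(mulmxA T1) PTP mulmx1.
  by rewrite [in RHS]WE trmx_mul mulmxA -(mulmxA T1 Q) QQ mulmx1.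
- rewrite !trmx_mul trmxK !mulmxA -(mulmxA _ Q) QQ mulmx1 -(mulmxA _ P) PP mulmx1.
  by rewrite tr_pid_mx pid_mx_id.
have -> : (T1 *m P^T *m J)^T *m G *m (T1 *m P^T *m J) = J^T *m diag_mx D *m J.
  by rewrite -PD !trmx_mul trmxK !mulmxA.
apply/is_diag_mxP => i j ij; rewrite mxE big1 // => x _.
rewrite mul_mx_diag !mxE.
case: eqP => [xi|_]; last by rewrite /= !mul0r.
case: eqP => [xj|_]; last by rewrite /= mulr0.
by rewrite -xi -xj eqxx in ij.
Qed.

End RealSpectral.

(** * Tucker format, Kronecker quadratic forms, the higher-order SVD, and perturbation of forms *)

Section Tucker.
Variable R : realType.

Lemma sqnorm_ge0 (I : finType) (v : I -> R) : 0 <= sqnorm v.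
Proof. by apply: sumr_ge0 => i _; apply: sqr_ge0. Qed.

Lemma eq_sqnorm (I : finType) (u v : I -> R) : u =1 v -> sqnorm u = sqnorm v.
Proof. by move=> uv; apply: eq_bigr => i _; rewrite uv. Qed.

Lemma sqnormZ (I : finType) (a : R) (v : I -> R) :
  sqnorm (fun i => a * v i) = a ^+ 2 * sqnorm v.
Proof. by rewrite /sqnorm mulr_sumr; apply: eq_bigr => i _; rewrite exprMn. Qed.

Lemma innervv (I : finType) (v : I -> R) : inner v v = sqnorm v.
Proof. by apply: eq_bigr => i _; rewrite expr2. Qed.

Lemma sqnormD (I : finType) (u v : I -> R) :
  sqnorm (fun i => u i + v i) = sqnorm u + 2 * inner u v + sqnorm v.
Proof.
rewrite /sqnorm /inner mulr_sumr -!big_split; apply: eq_bigr => i _ /=; ring.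
Qed.

Lemma enormE1 (I : finType) (v : I -> R) : enorm v = 1 <-> sqnorm v = 1.
Proof.
rewrite /enorm; split=> [|->]; last exact: sqrtr1.
by move/(congr1 (fun x => x ^+ 2)); rewrite sqr_sqrtr ?sqnorm_ge0 // expr1n.
Qed.

Lemma matvecD (I O : finType) (A : O -> I -> R) (u v : I -> R) o :
  matvec A (fun i => u i + v i) o = matvec A u o + matvec A v o.
Proof. by rewrite -big_split; apply: eq_bigr => i _; rewrite mulrDr. Qed.

Lemma matvecZ (I O : finType) (A : O -> I -> R) a (u : I -> R) o :
  matvec A (fun i => a * u i) o = a * matvec A u o.
Proof. by rewrite /matvec mulr_sumr; apply: eq_bigr => i _; rewrite mulrCA. Qed.

Lemma eq_matvec (I O : finType) (A : O -> I -> R) (u v : I -> R) :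
  u =1 v -> matvec A u =1 matvec A v.
Proof. by move=> uv o; apply: eq_bigr => i _; rewrite uv. Qed.

Definition tucker (I J K : finType) (C : {ffun I -> K} -> R)
    (u : I -> K -> J -> R) : {ffun I -> J} -> R :=
  fun l => \sum_kk C kk * \prod_b u b (kk b) (l b).

Lemma tucker_trans (I J K L : finType) (C : {ffun I -> K} -> R)
    (u : I -> K -> J -> R) (T : I -> K -> L -> R) (v : I -> L -> J -> R) :
  (forall b x j, u b x j = \sum_q T b x q * v b q j) ->
  tucker C u =1 tucker (tucker C T) v.
Proof.
move=> uE l; rewrite /tucker.
under [RHS]eq_bigr do rewrite mulr_suml.
rewrite [RHS]exchange_big; apply: eq_bigr => kk _ /=.
under eq_bigr do rewrite uE.
rewrite bigA_distr_bigA mulr_sumr; apply: eq_bigr => qq _.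
by rewrite big_split mulrA.
Qed.

Lemma modeprod_tucker (D m : nat) (J K : finType) (A : 'I_D -> 'I_m -> J -> R)
    (C : {ffun 'I_D -> K} -> R) (u : 'I_D -> K -> J -> R) :
  modeprod A (tucker C u) =1 tucker C (fun b x => matvec (A b) (u b x)).
Proof.
move=> l; rewrite /modeprod /tucker.
under eq_bigr do rewrite mulr_sumr.
rewrite exchange_big; apply: eq_bigr => kk _ /=.
rewrite /matvec bigA_distr_bigA mulr_sumr; apply: eq_bigr => j _.
by rewrite big_split mulrCA.
Qed.

(** The quadratic form of the Kronecker product of the matrices [M c], evaluated at the vectorized
    core. Norms, slice inner products and Gram matrices are all instances of it. *)
Definition qform (I K : finType) (M : I -> K -> K -> R) (C : {ffun I -> K} -> R) : R :=
  \sum_kk \sum_kk' C kk * C kk' * \prod_c M c (kk c) (kk' c).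

Lemma eq_qform (I K : finType) (M N : I -> K -> K -> R) (C : {ffun I -> K} -> R) :
  (forall c x y, M c x y = N c x y) -> qform M C = qform N C.
Proof.
move=> MN; apply: eq_bigr => kk _; apply: eq_bigr => kk' _; congr (_ * _).
by apply: eq_bigr => c _.
Qed.

Lemma prod_delta (I K : finType) (f g : {ffun I -> K}) :
  \prod_c (f c == g c)%:R = (f == g)%:R :> R.
Proof.
have [->|fg] := eqVneq f g; first by rewrite big1 // => c _; rewrite eqxx.
have [c fgc] : exists c, f c != g c.
  apply/existsP; rewrite -negb_forall; apply: contra fg => /forallP fg.
  by apply/eqP/ffunP => c; apply/eqP.
by rewrite (bigD1 c) //= (negPf fgc) mul0r.
Qed.

Lemma qform_delta (I K : finType) (C : {ffun I -> K} -> R) :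
  qform (fun _ x y => (x == y)%:R) C = sqnorm C.
Proof.
apply: eq_bigr => kk _; rewrite (bigD1 kk) //= [X in _ + X]big1 => [|kk' kk'N].
  by rewrite addr0 prod_delta eqxx mulr1 expr2.
by rewrite prod_delta eq_sym (negPf kk'N) mulr0.
Qed.

Lemma sum_prod2 (I K L : finType) (F : I -> K -> L -> R) :
  \sum_(kk : {ffun I -> K}) \sum_(ll : {ffun I -> L}) \prod_c F c (kk c) (ll c)
  = \prod_c \sum_x \sum_y F c x y.
Proof.
rewrite [RHS]bigA_distr_bigA; apply: eq_bigr => kk _.
by rewrite bigA_distr_bigA.
Qed.

(** Changing frame in the tensor is a congruence in each mode of the form. *)
Lemma qform_tucker (I J K : finType) (M : I -> J -> J -> R)
    (C : {ffun I -> K} -> R) (u : I -> K -> J -> R) :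
  qform M (tucker C u) =
  qform (fun c x y => \sum_p \sum_q u c x p * u c y q * M c p q) C.
Proof.
rewrite /qform; under [RHS]eq_bigr => gg _ do under eq_bigr => gg' _
  do rewrite -sum_prod2 mulr_sumr.
under [RHS]eq_bigr => gg _ do under eq_bigr => gg' _ do
  under eq_bigr => kk _ do rewrite mulr_sumr.
under [RHS]eq_bigr => gg _ do rewrite exchange_big.
rewrite [RHS]exchange_big; apply: eq_bigr => kk _ /=.
under [RHS]eq_bigr => gg _ do rewrite exchange_big.
rewrite [RHS]exchange_big; apply: eq_bigr => kk' _ /=.
rewrite /tucker mulr_suml mulr_suml; apply: eq_bigr => gg _.
rewrite mulr_sumr mulr_suml; apply: eq_bigr => gg' _.
rewrite !big_split /=; ring.
Qed.

Lemma sum_delta2 (J : finType) (F : J -> J -> R) :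
  \sum_p \sum_q F p q * (p == q)%:R = \sum_p F p p.
Proof.
apply: eq_bigr => p _; rewrite (bigD1 p) //= big1 ?addr0 ?eqxx ?mulr1 //.
by move=> q qp; rewrite eq_sym (negPf qp) mulr0.
Qed.

Lemma sqnorm_tucker (I J K : finType) (C : {ffun I -> K} -> R) (u : I -> K -> J -> R) :
  sqnorm (tucker C u) = qform (fun c x y => inner (u c x) (u c y)) C.
Proof.
by rewrite -qform_delta qform_tucker; apply: eq_qform => c x y; rewrite sum_delta2.
Qed.

Definition set_mode (I : finType) (K : Type) (b : I) (f : K -> K -> R)
    (M : I -> K -> K -> R) (c : I) : K -> K -> R :=
  if c == b then f else M c.

(** Linearity in the matrix of mode [b], expanded over elementary matrices. *)
Lemma qform_set_mode (I K : finType) (b : I) (f : K -> K -> R)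
    (M : I -> K -> K -> R) (C : {ffun I -> K} -> R) :
  qform (set_mode b f M) C =
  \sum_x \sum_y f x y *
    qform (set_mode b (fun x' y' => (x' == x)%:R * (y' == y)%:R) M) C.
Proof.
rewrite /qform.
under [RHS]eq_bigr => x _ do under eq_bigr => y _ do rewrite mulr_sumr.
under [RHS]eq_bigr => x _ do rewrite exchange_big.
rewrite [RHS]exchange_big; apply: eq_bigr => kk _ /=.
under [RHS]eq_bigr => x _ do under eq_bigr => y _ do rewrite mulr_sumr.
under [RHS]eq_bigr => x _ do rewrite exchange_big.
rewrite [RHS]exchange_big; apply: eq_bigr => kk' _ /=.
have modeE h : \prod_c set_mode b h M c (kk c) (kk' c) =
    h (kk b) (kk' b) * \prod_(c | c != b) M c (kk c) (kk' c).
  rewrite (bigD1 b) //= {1}/set_mode eqxx; congr (_ * _).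
  by apply: eq_bigr => c cb; rewrite /set_mode (negPf cb).
rewrite modeE (bigD1 (kk b)) //= (bigD1 (kk' b)) //= modeE !eqxx !mul1r.
rewrite [X in _ + X + _]big1 => [|y yN]; last first.
  by rewrite modeE eqxx (eq_sym (kk' b)) (negPf yN) mulr0 mul0r !mulr0.
rewrite [X in _ + X]big1 => [|x xN]; last first.
  apply: big1 => y _.
  by rewrite modeE (eq_sym (kk b)) (negPf xN) !mul0r !mulr0.
by rewrite !addr0 mulrCA.
Qed.

Lemma qform_tr (I K : finType) (M : I -> K -> K -> R) (C : {ffun I -> K} -> R) :
  qform (fun c x y => M c y x) C = qform M C.
Proof.
rewrite /qform exchange_big; apply: eq_bigr => kk _; apply: eq_bigr => kk' _ /=.
by rewrite [C kk' * _]mulrC.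
Qed.

(** Puts the orthogonality of subtensors into a shape to which [qform_tucker] applies: an elementary
    matrix in mode [b], identities elsewhere. *)
Lemma sum_upd (D s : nat) (C : {ffun 'I_D -> 'I_s} -> R) b (p q : 'I_s) :
  \sum_(kk : {ffun 'I_D -> 'I_s} | kk b == p) C kk * C (upd kk b q) =
  qform (set_mode b (fun x y => (x == p)%:R * (y == q)%:R)
                    (fun _ x y => (x == y)%:R)) C.
Proof.
rewrite big_mkcond; apply: eq_bigr => kk _ /=.
have modeE (kk' : {ffun 'I_D -> 'I_s}) : \prod_c set_mode b (fun x y => (x == p)%:R * (y == q)%:R)
      (fun _ x y => (x == y)%:R) c (kk c) (kk' c) =
    (kk b == p)%:R * (kk' == upd kk b q)%:R :> R.
  rewrite -prod_delta (bigD1 b) //= [in RHS](bigD1 b) //= {1}/set_mode !eqxx mulrA.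
  rewrite ffunE eqxx; congr (_ * _); apply: eq_bigr => c cb.
  by rewrite /set_mode ffunE (negPf cb) eq_sym.
rewrite (bigD1 (upd kk b q)) //= modeE eqxx mulr1 big1 => [|kk' kk'N].
  by rewrite addr0; case: eqP; rewrite ?mulr1 ?mulr0.
by rewrite modeE (negPf kk'N) !mulr0.
Qed.

(** [diagonalizing_factor] for a family indexed by any finite type, through its enumeration. The
    lengths are only bounded by 1 because vectors beyond the rank vanish. *)
Lemma diagonalizing_frame (m : nat) (K : finType) (w : K -> 'I_m -> R) (G : K -> K -> R) :
  (forall x y, G x y = G y x) ->
  exists Tu : (K -> 'I_#|K| -> R) * ('I_#|K| -> 'I_m -> R),
    [/\ forall x j, w x j = \sum_q Tu.1 x q * Tu.2 q j,
        forall x y, \sum_q Tu.1 x q * Tu.1 y q = inner (w x) (w y),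
        forall p q, p != q -> inner (Tu.2 p) (Tu.2 q) = 0,
        forall p, sqnorm (Tu.2 p) <= 1 &
        forall p q, p != q -> \sum_x \sum_y Tu.1 x p * Tu.1 y q * G x y = 0].
Proof.
move=> symG; pose W := \matrix_(i < #|K|, j < m) w (enum_val i) j.
have [|T [u [WTu TT uu TGT]]] :=
    @diagonalizing_factor _ _ _ W (\matrix_(i, j) G (enum_val i) (enum_val j)).
  by apply/matrixP => i j; rewrite !mxE.
exists (fun x q => T (enum_rank x) q, fun q j => u q j) => /=; split.
- by move=> x j; move/matrixP/(_ (enum_rank x) j): WTu; rewrite !mxE enum_rankK.
- move=> x y; move/matrixP/(_ (enum_rank x) (enum_rank y)): TT.
  rewrite !mulmx_trmxE => ->; apply: eq_bigr => j _.
  by rewrite !mxE !enum_rankK.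
- move=> p q pq; move/matrixP/(_ p q): uu; rewrite mulmx_trmxE /inner => ->.
  by rewrite mxE (negPf pq : (val p == val q) = false).
- move=> p; move/matrixP/(_ p p): uu; rewrite mulmx_trmx_diag /sqnorm => ->.
  by rewrite mxE lern1 leq_b1.
move=> p q pq; move/is_diag_mxP/(_ p q pq): TGT; rewrite mxE => TGT0; rewrite -[RHS]TGT0.
rewrite exchange_big (reindex_onto enum_val enum_rank) /= => [|x _]; last exact: enum_rankK.
apply: eq_big => [y|y _]; first by rewrite enum_valK eqxx.
rewrite mxE mulr_suml (reindex_onto enum_val enum_rank) /= => [|x _]; last exact: enum_rankK.
apply: eq_big => [x|x _]; first by rewrite enum_valK eqxx.
by rewrite !mxE !enum_valK mulrAC.
Qed.

Lemma hosvd (D m : nat) (K : finType) (G : {ffun 'I_D -> K} -> R)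
    (w : 'I_D -> K -> 'I_m -> R) :
  exists (u : 'I_D -> 'I_#|K| -> 'I_m -> R) (C : {ffun 'I_D -> 'I_#|K|} -> R),
    [/\ tucker G w =1 tucker C u,
        forall b p, sqnorm (u b p) <= 1,
        forall b p q, p != q -> inner (u b p) (u b q) = 0,
        sqnorm C = sqnorm (tucker G w) &
        forall b p q, p != q ->
          \sum_(kk : {ffun 'I_D -> 'I_#|K|} | kk b == p) C kk * C (upd kk b q) = 0].
Proof.
(* [gram b] collects the inner products of the mode-[b] slices of [G], measured with the Gram
   matrices of [w] in the other modes. It does not involve [w b], so all modes can be diagonalized
   independently. *)
pose gram b x y := qform (set_mode b (fun x' y' => (x' == x)%:R * (y' == y)%:R)
                           (fun c x' y' => inner (w c x') (w c y'))) G.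
have gram_sym b x y : gram b x y = gram b y x.
  rewrite /gram -qform_tr; apply: eq_qform => c x' y'; rewrite /set_mode.
  case: (c == b); first by rewrite mulrC.
  by apply: eq_bigr => j _; rewrite mulrC.
have /fin_all_exists[Tu TuP] b := diagonalizing_frame (w b) (gram_sym b).
pose T b := (Tu b).1; pose u b := (Tu b).2.
exists u, (tucker G T); split.
- by apply: tucker_trans => b x j; have [->] := TuP b.
- by move=> b p; have [_ _ _ ->] := TuP b.
- by move=> b p q pq; have [_ _ ->] := TuP b.
- rewrite !sqnorm_tucker; apply: eq_qform => b x y.
  by have [_ <-] := TuP b.
(* In a mode [c] other than [b], the congruence turns the identity into the Gram matrix of [w c].
   The form is therefore the off-diagonal entry at [p], [q] of [gram b] congruated by [T b], which
   vanishes by the choice of [T b]. *)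
move=> b p q pq; rewrite sum_upd qform_tucker.
have [_ _ _ _ /(_ p q pq) TuG] := TuP b; rewrite -[RHS]TuG.
rewrite -(qform_set_mode b (fun x y => T b x p * T b y q)).
apply: eq_qform => c x y; rewrite /set_mode; case: eqP => [->|_]; last first.
  by rewrite sum_delta2; have [_ ->] := TuP c.
rewrite (bigD1 p) //= (bigD1 q) //= !eqxx !mulr1 big1 => [|q' q'N]; last first.
  by rewrite (negPf q'N) !mulr0.
rewrite big1 ?addr0 // => p' p'N.
by apply: big1 => q' _; rewrite (negPf p'N) mul0r mulr0.
Qed.

Lemma nearly_orth_tucker (D m : nat) (K : finType) (G : {ffun 'I_D -> K} -> R)
    (w : 'I_D -> K -> 'I_m -> R) (rad mu theta : R) (Z : {ffun 'I_D -> 'I_m} -> R) :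
  1 <= rad -> 0 <= mu -> theta <= 1 -> Z =1 tucker G w -> sqnorm Z = 1 ->
  nearly_orth #|K| rad mu theta Z.
Proof.
move=> rad1 mu0 theta1 ZE Z1; have [u [C [GC u1 uu C1 Corth]]] := hosvd G w.
exists u, C; split; first by move=> l; rewrite ZE GC.
split=> [b p|].
  by rewrite (le_trans _ rad1) // -(sqrtr1 R) ler_sqrt.
split=> [b p q pq|]; first by rewrite uu // normr0.
split; first by apply/enormE1; rewrite C1 -Z1; apply/esym/eq_sqnorm.
by split=> //; rewrite /enorm Z1 sqrtr1.
Qed.

(** Induction over the product; besides the distance bound, the invariant [P] must carry the size
    bounds used to split [x * x' - y * y']. *)
Lemma prod_dist (I : finType) (a b e : I -> R) :
  (forall i, 0 <= b i) -> (forall i, `|a i - b i| <= e i) ->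
  `|\prod_i a i - \prod_i b i| <= \prod_i (b i + e i) - \prod_i b i.
Proof.
move=> b0 ab.
pose P x y z := [/\ 0 <= y, `|x| <= z & `|x - y| <= z - y :> R].
suff [] : P (\prod_i a i) (\prod_i b i) (\prod_i (b i + e i)) by [].
apply: (big_ind3 P) => [|x y z x' y' z' [y0 xz xy] [y'0 xz' xy']|i _].
- by split; rewrite ?ler01 ?normr1 ?subrr ?normr0.
- split; first exact: mulr_ge0.
    by rewrite normrM ler_pM.
  have -> : x * x' - y * y' = x * (x' - y') + (x - y) * y' by ring.
  have -> : z * z' - y * y' = z * (z' - y') + (z - y) * y' by ring.
  rewrite (le_trans (ler_normD _ _)) // lerD // normrM.
    by rewrite ler_pM.
  by rewrite (ger0_norm y'0) ler_wpM2r.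
split=> //; last by rewrite addrAC subrr add0r.
rewrite -(subrK (b i) (a i)) (le_trans (ler_normD _ _)) //.
by rewrite (ger0_norm (b0 i)) addrC lerD2l.
Qed.

(** Schur test: the deviation is dominated entrywise by a symmetric kernel [W]. Its row sums factor
    over the modes, each contributing [1 + #|K| eps], minus the 1 of the identity. *)
Lemma qform_near_delta (I K : finType) (M : I -> K -> K -> R) (eps : R)
    (C : {ffun I -> K} -> R) :
  (forall c x y, `|M c x y - (x == y)%:R| <= eps) ->
  `|qform M C - sqnorm C| <= ((1 + #|K|%:R * eps) ^+ #|I| - 1) * sqnorm C.
Proof.
move=> Meps.
pose W (kk kk' : {ffun I -> K}) : R :=
  \prod_c ((kk c == kk' c)%:R + eps) - \prod_c (kk c == kk' c)%:R.
have Wle (kk kk' : {ffun I -> K}) : `|\prod_c M c (kk c) (kk' c) - \prod_c (kk c == kk' c)%:R| <= W kk kk'.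
  by apply: prod_dist => c; [exact: ler0n | exact: Meps].
have W0 kk kk' : 0 <= W kk kk' by rewrite (le_trans _ (Wle kk kk')).
have Wsym kk kk' : W kk kk' = W kk' kk.
  by congr (_ - _); apply: eq_bigr => c _; rewrite eq_sym.
have Wsum kk : \sum_kk' W kk kk' = (1 + #|K|%:R * eps) ^+ #|I| - 1.
  rewrite sumrB; congr (_ - _).
    rewrite -(bigA_distr_bigA (fun c x => (kk c == x)%:R + eps)).
    rewrite -prodr_const; apply: eq_bigr => c _.
    rewrite big_split /= sumr_const mulr_natl; congr (_ + _).
    rewrite (bigD1 (kk c)) //= eqxx big1 ?addr0 // => x.
    by rewrite eq_sym => /negPf->.
  rewrite (bigD1 kk) //= prod_delta eqxx big1 ?addr0 // => kk' kk'N.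
  by rewrite prod_delta eq_sym (negPf kk'N).
have -> : qform M C - sqnorm C =
    \sum_kk \sum_kk' C kk * C kk' * (\prod_c M c (kk c) (kk' c) - \prod_c (kk c == kk' c)%:R).
  rewrite -qform_delta -sumrB; apply: eq_bigr => kk _.
  by rewrite -sumrB; apply: eq_bigr => kk' _; rewrite mulrBr.
(* The product of two core entries is at most half the sum of their squares; by symmetry of [W] both
   halves give the same row-sum bound. *)
apply: le_trans (_ : \sum_kk \sum_kk' (C kk ^+ 2 / 2 * W kk kk' + C kk' ^+ 2 / 2 * W kk kk') <= _).
  rewrite (le_trans (ler_norm_sum _ _ _)) //; apply: ler_sum => kk _.
  rewrite (le_trans (ler_norm_sum _ _ _)) //; apply: ler_sum => kk' _.
  rewrite normrM -mulrDl ler_pM //.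
  rewrite ler_norml; have := sqr_ge0 (C kk - C kk'); have := sqr_ge0 (C kk + C kk').
  by rewrite !expr2 => h1 h2; apply/andP; split; lra.
have half : \sum_kk \sum_kk' C kk ^+ 2 / 2 * W kk kk' =
    ((1 + #|K|%:R * eps) ^+ #|I| - 1) * sqnorm C / 2.
  rewrite /sqnorm mulr_sumr mulr_suml; apply: eq_bigr => kk _.
  by rewrite -mulr_sumr Wsum; ring.
have half' : \sum_kk \sum_kk' C kk' ^+ 2 / 2 * W kk kk' =
    ((1 + #|K|%:R * eps) ^+ #|I| - 1) * sqnorm C / 2.
  rewrite -half exchange_big; apply: eq_bigr => kk _; apply: eq_bigr => kk' _.
  by rewrite Wsym.
under eq_bigr do rewrite big_split.
by rewrite big_split /= half half'; lra.
Qed.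

End Tucker.

(** * Gram matrices of compressed frames, and reshaping *)

Section ModewiseRIP.
Variable R : realType.

Lemma inner_kron (k n : nat) (u v : 'I_k -> 'I_n -> R) :
  inner (kron u) (kron v) = \prod_c inner (u c) (v c).
Proof.
rewrite /inner bigA_distr_bigA; apply: eq_bigr => j _.
by rewrite -big_split.
Qed.

Lemma sqnorm_S1 (k n : nat) (x : {ffun 'I_k -> 'I_n} -> R) : S1 x -> sqnorm x = 1.
Proof.
move=> [u [u1 xE]]; rewrite (eq_sqnorm xE) -innervv inner_kron big1 // => c _.
by rewrite innervv; apply/enormE1.
Qed.

(** The sign is absorbed by the first Kronecker factor, hence [0 < k]. *)
Lemma S1_opp (k n : nat) (x : {ffun 'I_k -> 'I_n} -> R) :
  (0 < k)%N -> S1 x -> S1 (fun j => - x j).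
Proof.
case: k x => // k x _ [u [u1 xE]].
exists (fun c i => (-1) ^+ (c == ord0) * u c i); split=> [c|j].
  by apply/enormE1; rewrite sqnormZ sqrr_sign mul1r; apply/enormE1.
by rewrite xE /kron !big_ord_recl /= expr1 mulN1r mulNr;
   congr (- (_ * _)); apply: eq_bigr => c _; rewrite expr0 mul1r.
Qed.

Section Gram.
Variables (k n : nat) (O : finType) (A : O -> {ffun 'I_k -> 'I_n} -> R) (eps : R).
Hypothesis Arip : RIP (matvec A) eps (@S12 R k n).

Lemma RIP_S1 x : S1 x -> `|sqnorm (matvec A x) - 1| <= eps.
Proof.
move=> xS; have /andP[] := Arip (or_introl xS : S12 x).
by rewrite sqnorm_S1 // => h1 h2; rewrite ler_norml; apply/andP; split; lra.
Qed.

(** Orthogonal unit vectors have a sum of squared length 2, so this is the RIP at the normalized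
    sum, multiplied by 2. *)
Lemma RIP_S2 x y : S1 x -> S1 y -> inner x y = 0 ->
  2 * (1 - eps) <= sqnorm (matvec A x) + 2 * inner (matvec A x) (matvec A y)
                   + sqnorm (matvec A y) <= 2 * (1 + eps).
Proof.
move=> xS yS xy; pose e := enorm (fun j => x j + y j).
have e2 : e ^+ 2 = 2.
  by rewrite /e /enorm sqr_sqrtr ?sqnorm_ge0 // sqnormD xy !sqnorm_S1 //; ring.
pose s j := (x j + y j) / e.
have sE j : s j = e^-1 * (x j + y j) by rewrite mulrC.
have /Arip : S12 s by right; exists x, y.
rewrite (eq_sqnorm sE) (eq_sqnorm (eq_matvec A sE)).
rewrite (eq_sqnorm (matvecZ A e^-1 (fun j => x j + y j))) !sqnormZ.
rewrite (eq_sqnorm (matvecD A x y)) !sqnormD xy !sqnorm_S1 // exprVn e2.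
by move=> /andP[h1 h2]; apply/andP; split; lra.
Qed.

(** Polarization: comparing [RIP_S2] for [x, y] and for [x, -y] bounds four times the inner product
    by [4 eps]. *)
Lemma RIP_inner x y : (0 < k)%N -> S1 x -> S1 y -> inner x y = 0 ->
  `|inner (matvec A x) (matvec A y)| <= eps.
Proof.
move=> k0 xS yS xy.
have /andP[h1 h2] := RIP_S2 xS yS xy.
have yN : (fun j => - y j) =1 (fun j => -1 * y j) by move=> j; rewrite mulN1r.
have innerN (I : finType) (u v : I -> R) : inner u (fun j => - v j) = - inner u v.
  by rewrite /inner -sumrN; apply: eq_bigr => j _; rewrite mulrN.
have xyN : inner x (fun j => - y j) = 0 by rewrite innerN xy oppr0.
have AyN : matvec A (fun j => - y j) =1 (fun o => - matvec A y o).
  by move=> o; rewrite (eq_matvec A yN) matvecZ mulN1r.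
have /andP[] := RIP_S2 xS (S1_opp k0 yS) xyN.
have -> : inner (matvec A x) (matvec A (fun j => - y j)) = - inner (matvec A x) (matvec A y).
  by rewrite -innerN; apply: eq_bigr => o _; rewrite AyN.
have -> : sqnorm (matvec A (fun j => - y j)) = sqnorm (matvec A y).
  by rewrite (eq_sqnorm AyN); apply: eq_bigr => o _; rewrite sqrrN.
by move=> h3 h4; rewrite ler_norml; apply/andP; split; lra.
Qed.

Lemma RIP_eps_ge0 : (0 < n)%N -> 0 <= eps.
Proof.
move=> n0; pose u (c : 'I_k) (i : 'I_n) : R := (i == Ordinal n0)%:R.
have uS : S1 (kron u).
  exists u; split=> // c; apply/enormE1.
  rewrite /sqnorm (bigD1 (Ordinal n0)) //= big1 => [|i /negPf iN].
    by rewrite /u eqxx expr1n addr0.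
  by rewrite /u iN expr0n.
exact: le_trans (normr_ge0 _) (RIP_S1 uS).
Qed.

End Gram.

(** Grouping modes only reindexes the core, while the frame vectors of each group combine into
    Kronecker products. The map [f] sends block [b] and offset [c] to mode [k * b + c]. *)
Lemma reshape_tucker (d k n : nat) (K : finType) (G : {ffun 'I_d -> K} -> R)
    (u : 'I_d -> K -> 'I_n -> R) : (0 < k)%N -> (k %| d)%N ->
  exists (f : 'I_(d %/ k) -> 'I_k -> 'I_d)
         (H : {ffun 'I_(d %/ k) -> {ffun 'I_k -> K}} -> R),
    sqnorm H = sqnorm G /\
    Defs.reshape (tucker G u) =1
      tucker H (fun b (x : {ffun 'I_k -> K}) => kron (fun c => u (f b c) (x c))).
Proof.
move=> k0 kd.
have f_lt (b : 'I_(d %/ k)) (c : 'I_k) : (k * b + c < d)%N.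
  rewrite -[X in (_ < X)%N](divnK kd) mulnC (@leq_trans (b.+1 * k)%N) //.
    by rewrite mulSn addnC ltn_add2r.
  by rewrite leq_mul2r ltn_ord orbT.
pose f b c : 'I_d := Ordinal (f_lt b c).
pose f2 (bc : 'I_(d %/ k) * 'I_k) := f bc.1 bc.2.
(* Quotient and remainder by [k] recover the block and the offset; equal cardinalities then make
   [f2] a bijection. *)
have f2_inj : injective f2.
  move=> [b c] [b' c'] /(congr1 val) /= E; congr pair; apply: val_inj => /=.
    have := congr1 (divn^~ k) E.
    by rewrite ![(k * _)%N]mulnC !divnMDl // !(divn_small (ltn_ord _)) ?addn0.
  have := congr1 (modn^~ k) E.
  by rewrite ![(k * _)%N]mulnC !modnMDl !modn_small.
have [g f2K gK] : bijective f2.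
  by apply: inj_card_bij => //; rewrite card_prod !card_ord divnK.
have fK a : f (g a).1 (g a).2 = a := gK a.
have gfK b c : g (f b c) = (b, c) := f2K (b, c).
pose flat (T : finType) (j : {ffun 'I_(d %/ k) -> {ffun 'I_k -> T}}) : {ffun 'I_d -> T} :=
  [ffun a => j (g a).1 (g a).2].
have flat_bij (T : finType) : bijective (@flat T).
  exists (fun i : {ffun 'I_d -> T} => [ffun b => [ffun c => i (f b c)]]) => [j|i].
    by apply/ffunP => b; apply/ffunP => c; rewrite !ffunE gfK.
  by apply/ffunP => a; rewrite !ffunE fK.
have matchE (i : {ffun 'I_d -> 'I_n}) j : reshape_match i j = (i == flat _ j).
  apply/forallP/eqP => [ij|-> a].
    apply/ffunP => a; rewrite ffunE -{1}[a]fK.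
    have /forallP/(_ (g a).1)/forallP/(_ (g a).2)/implyP := ij (f (g a).1 (g a).2).
    by move=> /(_ (eqxx _))/eqP.
  apply/forallP => b; apply/forallP => c; apply/implyP => /eqP aE.
  have -> : a = f b c by apply: val_inj.
  by rewrite ffunE gfK.
exists f, (fun kk => G (flat _ kk)); split.
  rewrite /sqnorm [RHS](reindex (@flat K)) //=.
  exact: onW_bij.
move=> j; rewrite /Defs.reshape (eq_bigl _ _ (fun i => matchE i j)) big_pred1_eq.
rewrite /tucker (reindex (@flat K)) /=; last exact: onW_bij.
apply: eq_bigr => kk _; congr (_ * _).
rewrite /kron pair_bigA /= (reindex f2) /=; last by apply: onW_bij; exists g.
by apply: eq_bigr => -[b c] _; rewrite !ffunE /f2 /= gfK.
Qed.

Lemma hosvd_orthonormal (d n r : nat) (X : {ffun 'I_d -> 'I_n} -> R) : hosvd_le r X ->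
  exists (Q : 'I_d -> 'I_r -> 'I_n -> R) (G : {ffun 'I_d -> 'I_r} -> R),
    (forall a x y, inner (Q a x) (Q a y) = (x == y)%:R) /\ X =1 tucker G Q.
Proof.
move=> [U [rU [G XE]]].
have /fin_all_exists[TQ TQP] a : exists TQ : 'M[R]_r * 'M[R]_(r, n),
    U a = TQ.1 *m TQ.2 /\ TQ.2 *m TQ.2^T = 1%:M.
  have [|T [Q TQP]] := @orthonormal_factor _ _ _ (U a); last by exists (T, Q).
  by rewrite /row_free rU.
exists (fun a x i => (TQ a).2 x i), (tucker G (fun a x q => (TQ a).1 x q)); split.
  move=> a x y; have [_ /matrixP/(_ x y)] := TQP a.
  by rewrite mulmx_trmxE mxE.
move=> i; rewrite XE; apply: (@tucker_trans _ _ _ _ _ _ (fun a x i => U a x i)) => a x j.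
by have [-> _] := TQP a; rewrite mxE.
Qed.

Lemma sqnorm_tucker_orthonormal (I J K : finType) (C : {ffun I -> K} -> R)
    (u : I -> K -> J -> R) :
  (forall a x y, inner (u a x) (u a y) = (x == y)%:R) ->
  sqnorm (tucker C u) = sqnorm C.
Proof. by move=> uu; rewrite sqnorm_tucker (eq_qform _ uu) qform_delta. Qed.

(** A converse to Bernoulli's inequality: in the induction step the quadratic term [2 D x^2] is at
    most [x]. *)
Lemma exprD1_le (x : R) (D : nat) : 0 <= x -> 2 * D%:R * x <= 1 ->
  (1 + x) ^+ D <= 1 + 2 * D%:R * x.
Proof.
move=> x0; elim: D => [|D IH]; first by rewrite expr0 mulr0 mul0r addr0.
rewrite -natr1 => Dx; have D0 : 0 <= D%:R :> R by [].
have {}IH := IH ltac:(nra).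
rewrite exprSr (le_trans (ler_wpM2r _ IH)) ?addr_ge0 //; nra.
Qed.

End ModewiseRIP.

(** * Combination of the two stages *)

Theorem theorem2 (R : realType) (d n k r m m2 : nat) (eps : R)
  (A : 'I_(d %/ k) -> 'I_m -> {ffun 'I_k -> 'I_n} -> R)
  (A2 : 'I_m2 -> {ffun 'I_(d %/ k) -> 'I_m} -> R) :
  (1 <= d)%N -> (1 <= n)%N -> (1 <= k)%N -> (k %| d)%N -> (2 <= r)%N ->
  12 * (d %/ k)%:R * r%:R ^+ d * eps < 1 ->
  (forall b, RIP (matvec (A b)) eps (@S12 R k n)) ->
  RIP (matvec A2) (12 * (d %/ k)%:R * r%:R ^+ d * eps / 3)
      (@nearly_orth R (d %/ k) m (r ^ k) (1 + eps) eps
         (1 - 12 * (d %/ k)%:R * r%:R ^+ d * eps / 3)) ->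
  forall X : {ffun 'I_d -> 'I_n} -> R, hosvd_le r X ->
    (1 - 12 * (d %/ k)%:R * r%:R ^+ d * eps) * sqnorm X
      <= sqnorm (A2nd A2 A X)
      <= (1 + 12 * (d %/ k)%:R * r%:R ^+ d * eps) * sqnorm X.
Proof.
move=> d0 n0 k0 kd r2 + Arip A2rip X /hosvd_orthonormal[Q [G [QQ XE]]].
move: A2rip; set delta := 12 * _ * _ * eps => A2rip delta1.
pose K := {ffun 'I_k -> 'I_r}.
have cardK : #|{: K}| = (r ^ k)%N by rewrite card_ffun !card_ord.
have D0 : (0 < d %/ k)%N by rewrite divn_gt0 // dvdn_leq.
have eps0 : 0 <= eps := RIP_eps_ge0 (Arip (Ordinal D0)) n0.
have [f [H [HG reshapeE]]] := reshape_tucker G Q k0 kd.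
pose e b (x : K) := kron (fun c => Q (f b c) (x c)).
have ee b x y : inner (e b x) (e b y) = (x == y)%:R.
  rewrite inner_kron -prod_delta; apply: eq_bigr => c _; exact: QQ.
have eS b x : S1 (e b x).
  exists (fun c => Q (f b c) (x c)); split=> // c; apply/enormE1.
  by rewrite -innervv QQ eqxx.
pose w b (x : K) := matvec (A b) (e b x).
pose Z := modeprod A (Defs.reshape X).
have ZE : Z =1 tucker H w.
  move=> l; rewrite -[RHS]modeprod_tucker; apply: eq_bigr => j _; congr (_ * _).
  by rewrite -reshapeE; apply: eq_bigr => i _; rewrite XE.
have XH : sqnorm X = sqnorm H.
  by rewrite HG (eq_sqnorm XE) sqnorm_tucker_orthonormal.
(* Diagonal entries use the RIP on [S1], off-diagonal ones polarization on [S2]. *)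
have ww b x y : `|inner (w b x) (w b y) - (x == y)%:R| <= eps.
  have [->|xy] := eqVneq x y; first by rewrite innervv; apply: RIP_S1.
  by rewrite subr0; apply: RIP_inner; rewrite ?ee ?(negPf xy).
have := qform_near_delta H ww.
rewrite -sqnorm_tucker -(eq_sqnorm ZE) -XH card_ord cardK.
set N := sqnorm X; set z := sqnorm Z; set rho := _ ^+ _ - 1 => Zle.
have N0 : 0 <= N := sqnorm_ge0 X.
have z0 : 0 <= z := sqnorm_ge0 Z.
have delta0 : 0 <= delta by rewrite !mulr_ge0 // exprn_ge0.
(* As [k <= d], [r^k <= r^d], so [2 (d/k) r^k eps] is at most [delta / 6]; this is below 1, as
   [exprD1_le] requires. *)
have rho_le : rho <= delta / 6.
  have s_le : (r ^ k)%:R <= r%:R ^+ d :> R.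
    by rewrite -natrX ler_nat leq_pexp2l ?(ltnW r2) // dvdn_leq.
  have Ds : 2 * (d %/ k)%:R * ((r ^ k)%:R * eps) <= delta / 6.
    rewrite (_ : delta / 6 = 2 * (d %/ k)%:R * (r%:R ^+ d * eps)); last by rewrite /delta; field.
    by rewrite ler_wpM2l ?mulr_ge0 // ler_wpM2r.
  have := @exprD1_le R ((r ^ k)%:R * eps) (d %/ k).
  rewrite mulr_ge0 // => /(_ isT); rewrite /rho lerBlDl => E.
  by rewrite (le_trans (E _)) ?lerD2l //; lra.
have /andP[Q1 Q2] : (1 - delta / 3) * z <= sqnorm (matvec A2 Z) <= (1 + delta / 3) * z.
  have [z00|zN0] := eqVneq z 0.
    have Z0 l : Z l = 0.
      by apply/eqP; rewrite -sqrf_eq0; apply/eqP; move/psumr_eq0P: z00; apply=> // i _;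
        apply: sqr_ge0.
    rewrite z00 !mulr0 /sqnorm big1 ?lexx // => o _.
    by rewrite /matvec big1 ?expr0n // => l _; rewrite Z0 mulr0.
  (* The normalization [t] is put into the core [t * H], and the second-stage RIP scales back by
     homogeneity. *)
  pose t := (Num.sqrt z)^-1.
  have t2 : t ^+ 2 = z^-1 by rewrite exprVn sqr_sqrtr.
  have tZ1 : sqnorm (fun l => t * Z l) = 1 by rewrite sqnormZ t2 mulVf.
  have /A2rip : nearly_orth (r ^ k) (1 + eps) eps (1 - delta / 3) (fun l => t * Z l).
    rewrite -cardK; apply: (@nearly_orth_tucker _ _ _ _ (fun kk => t * H kk) w) => //.
    - by rewrite lerDl.
    - by rewrite gerBl divr_ge0.
    by move=> l; rewrite ZE /tucker mulr_sumr; apply: eq_bigr => kk _; rewrite mulrA.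
  rewrite tZ1 (eq_sqnorm (matvecZ A2 t Z)) sqnormZ t2 !mulr1 [z^-1 * _]mulrC.
  by rewrite ler_pdivlMr ?ler_pdivrMr ?lt_neqAle ?z0 ?andbT // eq_sym.
have := le_trans Zle (ler_wpM2r N0 rho_le); rewrite ler_norml => /andP[Z1 Z2].
change (sqnorm (A2nd A2 A X)) with (sqnorm (matvec A2 Z)).
have dN : 0 <= delta * N by apply: mulr_ge0.
have ddN : delta * (delta * N) <= delta * N by rewrite ler_piMl // ltW.
(* The factors of the two stages multiply to [1 - delta/2 + delta^2/18] and
   [1 + delta/2 + delta^2/18]; the upper bound uses [delta^2 <= delta]. *)
apply/andP; split.
- apply: le_trans Q1; apply: le_trans (_ : (1 - delta / 3) * (N - delta / 6 * N) <= _).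
    by have := mulr_ge0 delta0 dN; lra.
  by rewrite ler_wpM2l; lra.
- apply: le_trans Q2 _; apply: le_trans (_ : (1 + delta / 3) * (N + delta / 6 * N) <= _).
    by rewrite ler_wpM2l; lra.
  lra.
Qed.
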